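(* Let $(\mathcal X,d,\mu)$ be an RD-space. Let $\epsilon,\widetilde\epsilon\in(0,1)$ and $0<\beta,\gamma<\min\{\epsilon,\widetilde\epsilon\}$. Then $$\mathcal G_0^{\epsilon}(\beta,\gamma)=\mathcal G_0^{\widetilde\epsilon}(\beta,\gamma)\qquad\text{and}\qquad \mathring{\mathcal G}_0^{\epsilon}(\beta,\gamma)=\mathring{\mathcal G}_0^{\widetilde\epsilon}(\beta,\gamma).$$
   Context: Throughout, $(\mathcal X,d)$ is a metric space with a regular Borel measure $\mu$ such that all balls $B(x,r)=\{y\in\mathcal X:d(x,y)<r\}$ ($x\in\mathcal X$, $r>0$) have finite and positive measure; $\operatorname{diam}(\mathcal X)=\sup\{d(x,y):x,y\in\mathcal X\}$. $(\mathcal X,d,\mu)$ is a space of homogeneous type if there is a constant $C_0\in(1,\infty)$ with $\mu(B(x,2r))\le C_0\,\mu(B(x,r))$ for all $x\in\mathcal X$, $r>0$. It is an RD-space if it is a space of homogeneous type and there are constants $a_0,\widetilde C_0\in(1,\infty)$ such that $\mu(B(x,a_0r))\ge\widetilde C_0\,\mu(B(x,r))$ for all $x\in\mathcal X$ and $0<r<\operatorname{diam}(\mathcal X)/a_0$. Put $V(x,y)=\mu(B(x,d(x,y)))$ and $V_r(x)=\mu(B(x,r))$. Test functions. For $x_1\in\mathcal X$, $r\in(0,\infty)$, $\beta\in(0,1]$, $\gamma\in(0,\infty)$, the space $\mathcal G(x_1,r,\beta,\gamma)$ consists of all functions $\varphi:\mathcal X\to\mathbb C$ for which there is a constant $C\ge0$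 such that (1) $|\varphi(x)|\le C\,\frac{1}{V_r(x_1)+V(x_1,x)}\left[\frac{r}{r+d(x_1,x)}\right]^{\gamma}$ for all $x\in\mathcal X$; (2) $|\varphi(x)-\varphi(y)|\le C\left[\frac{d(x,y)}{r+d(x_1,x)}\right]^{\beta}\frac{1}{V_r(x_1)+V(x_1,x)}\left[\frac{r}{r+d(x_1,x)}\right]^{\gamma}$ for all $x,y\in\mathcal X$ with $d(x,y)\le[r+d(x_1,x)]/2$. Its norm $\|\varphi\|_{\mathcal G(x_1,r,\beta,\gamma)}$ is the infimum of such $C$. Fix $x_1\in\mathcal X$ once and for all and write $\mathcal G(\beta,\gamma)=\mathcal G(x_1,1,\beta,\gamma)$ (a Banach space) and $\mathring{\mathcal G}(\beta,\gamma)=\{f\in\mathcal G(\beta,\gamma):\int_{\mathcal X}f\,d\mu=0\}$. For $\epsilon\in(0,1]$ and $\beta,\gamma\in(0,\epsilon]$, $\mathcal G_0^{\epsilon}(\beta,\gamma)$ is the completion of $\mathcal G(\epsilon,\epsilon)$ in $\mathcal G(\beta,\gamma)$, i.e. the set of $\varphi\in\mathcal G(\beta,\gamma)$ for which there are $\phi_i\in\mathcal G(\epsilon,\epsilon)$, $i\in\mathbb N$, with $\|\varphi-\phi_i\|_{\mathcal G(\beta,\gamma)}\to0$; it carries the norm of $\mathcal G(\beta,\gamma)$. Likewise $\mathring{\mathcal G}_0^{\epsilon}(\beta,\gamma)$ is the completion (closure) of $\mathring{\mathcal G}(\epsilon,\epsilon)$ in $\mathring{\mathcal G}(\beta,\gamma)$,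 with the norm of $\mathcal G(\beta,\gamma)$. *)

(* Defs.v *)
From HB Require Import structures.
From mathcomp Require Import all_boot all_order all_algebra.
From mathcomp Require Import complex.
From mathcomp Require Import all_classical all_reals all_analysis.

Set Implicit Arguments.
Unset Strict Implicit.
Unset Printing Implicit Defensive.

Import Order.TTheory GRing.Theory Num.Theory.
Import numFieldTopology.Exports numFieldNormedType.Exports.

Local Open Scope classical_set_scope.
Local Open Scope ring_scope.

(* The point is only there because MathComp-Analysis measurable types are
   pointed; no definition below refers to it. *)
#[short(type="pmetricType")]
HB.structure Definition PointedMetric (K : numDomainType) :=
  { M of Metric K M & isPointed M }.

Definition borelType (R : realType) (X : pmetricType R) :=
  g_sigma_algebraType (@open X).

Section rd_spaces.
Context (R : realType) (X : pmetricType R).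
Variable mu : {measure set (borelType X) -> \bar R}.
Local Open Scope ereal_scope.

(* Regularity in the sense of measures on metric spaces: inner approximation is
   by closed sets. This is implied by inner regularity with respect to compact
   sets, and also holds for the Borel restriction of a Borel regular outer
   measure that is finite on balls. *)
Definition regular_measure : Prop :=
  forall A : set X, <<s @open X >> A ->
    mu A = ereal_inf [set mu U | U in [set U : set X | open U /\ A `<=` U]] /\
    mu A = ereal_sup [set mu F | F in [set F : set X | closed F /\ F `<=` A]].

Definition ball_measure_finite_pos : Prop :=
  forall (x : X) (r : R), (0 < r)%R -> 0 < mu (ball x r) < +oo.

Definition diam : \bar R := ereal_sup [set (mdist p.1 p.2)%:E | p in [set: X * X]].

Definition homogeneous_type : Prop :=
  exists2 C0 : R, (1 < C0)%R &
    forall (x : X) (r : R), (0 < r)%R ->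
      mu (ball x (2 * r)%R) <= C0%:E * mu (ball x r).

(* [(a0 * r)%:E < diam] is r < diam(X) / a0, where diam(X) may be +oo. *)
Definition RD_space : Prop :=
  homogeneous_type /\
  exists a0 C0' : R, [/\ (1 < a0)%R, (1 < C0')%R &
    forall (x : X) (r : R), (0 < r)%R -> (a0 * r)%:E < diam ->
      C0'%:E * mu (ball x r) <= mu (ball x (a0 * r)%R)].

End rd_spaces.

Section test_functions.
Context (R : realType) (X : pmetricType R).
Variable mu : {measure set (borelType X) -> \bar R}.

Definition Vr (r : R) (x : X) : R := fine (mu (ball x r)).

Definition V (x y : X) : R := Vr (mdist x y) x.

Definition test_size (x1 : X) (r gamma : R) (x : X) : R :=
  (Vr r x1 + V x1 x)^-1 * (r / (r + mdist x1 x)) `^ gamma.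

Definition test_bound (x1 : X) (r beta gamma : R) (phi : X -> R[i]) (C : R) : Prop :=
  [/\ 0 <= C,
      forall x, Normc.normc (phi x) <= C * test_size x1 r gamma x &
      forall x y, mdist x y <= (r + mdist x1 x) / 2 ->
        Normc.normc (phi x - phi y) <=
          C * (mdist x y / (r + mdist x1 x)) `^ beta * test_size x1 r gamma x].

Definition testG (x1 : X) (r beta gamma : R) : set (X -> R[i]) :=
  [set phi | exists C, test_bound x1 r beta gamma phi C].

Definition testG_norm (x1 : X) (r beta gamma : R) (phi : X -> R[i]) : R :=
  inf [set C | test_bound x1 r beta gamma phi C].

(* A measurable function that is not integrable never has extended integral 0
   (oo - oo is -oo here), so integrability is part of this condition. *)
Definition integral_zero (f : X -> R[i]) : Prop :=
  (\int[mu]_x (complex.Re (f x))%:E = 0 /\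
   \int[mu]_x (complex.Im (f x))%:E = 0)%E.

Definition testG_mean0 (x1 : X) (r beta gamma : R) : set (X -> R[i]) :=
  [set f | testG x1 r beta gamma f /\ integral_zero f].

Definition testG_cvg (x1 : X) (beta gamma : R)
    (phi_ : nat -> X -> R[i]) (phi : X -> R[i]) : Prop :=
  testG_norm x1 1 beta gamma (phi \- phi_ i) @[i --> \oo] --> (0 : R).

(* The two completions are sets of functions; both carry the norm
   [testG_norm x1 1 beta gamma], whatever epsilon is. *)
Definition testG0 (x1 : X) (eps beta gamma : R) : set (X -> R[i]) :=
  [set phi | testG x1 1 beta gamma phi /\
    exists2 phi_ : nat -> X -> R[i],
      forall i, testG x1 1 eps eps (phi_ i) & testG_cvg x1 beta gamma phi_ phi].

Definition testG0_mean0 (x1 : X) (eps beta gamma : R) : set (X -> R[i]) :=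
  [set phi | testG_mean0 x1 1 beta gamma phi /\
    exists2 phi_ : nat -> X -> R[i],
      forall i, testG_mean0 x1 1 eps eps (phi_ i) & testG_cvg x1 beta gamma phi_ phi].

End test_functions.

(* Main.v *)
Require Import Defs.
From HB Require Import structures.
From mathcomp Require Import all_boot all_order all_algebra.
From mathcomp Require Import complex ring lra.
From mathcomp Require Import all_classical all_reals all_analysis.
From mathcomp Require Import measurable_realfun.

Set Implicit Arguments.
Unset Strict Implicit.
Unset Printing Implicit Defensive.

Import Order.TTheory GRing.Theory Num.Theory.
Import numFieldTopology.Exports numFieldNormedType.Exports.

Local Open Scope classical_set_scope.
Local Open Scope ring_scope.

(** Why the theorem holds.  Both completions are closures for the norm of
    G(beta, gamma), so it is enough that each function of G(eps, eps) is a
    G(beta, gamma)-limit of Lipschitz functions with bounded support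
    ([testG_dense]): such functions lie in G(a, a) for every a in (0, 1]
    ([bounded_support_lipschitz_test]), hence in G(eps', eps').

    The engine is an interpolation principle ([real_test_bound_small]): on a
    bounded subset of G(eps, eps) the topology of uniform convergence is finer
    than that of G(beta, gamma), because beta and gamma are strictly smaller
    than eps.  The surplus exponents make the two defining quotients small where
    1 / (1 + d(x1, x)) or d(x, y) / (1 + d(x1, x)) is small, and what is left is a
    ball on which the weights are bounded below, where uniform smallness suffices.

    Let f >= 0 be real in G(eps, eps) ([approx_nonneg]).  For a small eta the
    function F = (f - eta)^+ has bounded support, and f - F is bounded by eta and
    obeys the same G(eps, eps) estimates as f, being the 1-Lipschitz function
    min(., eta) of f.  So F is close to f.  On functions with support in a fixed
    ball, G(eps, eps) estimates amount to global Hoelder estimates, and the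
    inf-convolutions inf_y (F(y) + L d(x, y)) of F are Lipschitz, lie between 0
    and F, converge to F uniformly as L grows and are Hoelder of exponent eps
    uniformly in L ([inf_convolution]; this uses eps < 1).  Interpolation applies
    once more.  Positive and negative parts, then real and imaginary parts, give
    the general case.

    For mean zero functions ([approx_real_mean0]) the approximants g of f satisfy
    |g| <= |f|, and f is integrable since its integral is 0; by dominated
    convergence the integrals of the approximants tend to 0, and subtracting a
    small multiple of one fixed bump function with positive integral restores
    mean zero without spoiling the approximation. *)

(** * Powers of real numbers *)

Section powers.
Context {R : realType}.
Implicit Types a b d e t u C : R.

Lemma powR_mul_compl {e t} : 0 <= t -> t `^ e * t `^ (1 - e) = t.
Proof.
move=> t0; rewrite -powRD; last by rewrite addrC subrK oner_eq0.
by rewrite addrC subrK powRr1.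
Qed.

Lemma powR_le1 {e t} : 0 <= e -> 0 <= t <= 1 -> t `^ e <= 1.
Proof.
move=> e0 /andP[t0 t1]; have := @ge0_ler_powR R e e0 t 1.
by rewrite powR1 !nnegrE t0 ler01; apply.
Qed.

Lemma powR_subrK {a b t} : 0 < b -> b <= a -> t `^ a = t `^ (a - b) * t `^ b.
Proof.
move=> b0 ba; rewrite -powRD; last by rewrite subrK gt_eqF ?(lt_le_trans b0).
by rewrite subrK.
Qed.

Lemma powR_decr {a b t} : 0 < b -> b <= a -> 0 <= t <= 1 -> t `^ a <= t `^ b.
Proof.
move=> b0 ba t01; rewrite (powR_subrK b0 ba) ler_piMl ?powR_ge0//.
by apply: powR_le1 => //; rewrite subr_ge0.
Qed.

(** The bound is uniform over all exponents [a >= e], so that one threshold [s]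
    controls the decay and the Hoelder surplus exponents at the same time. *)
Lemma powR_small {C d e} : 0 <= C -> 0 < d -> 0 < e ->
  exists2 s, 0 < s <= 1 & forall u a, 0 <= u <= s -> e <= a -> C * u `^ a <= d.
Proof.
move=> C0 d0 e0; pose s := Num.min 1 ((d / (C + 1)) `^ e^-1).
have C1 : 0 < C + 1 by lra.
have s0 : 0 < s by rewrite lt_min ltr01 powR_gt0// divr_gt0.
have s1 : s <= 1 by rewrite ge_min lexx.
exists s => [|u a /andP[u0 us] ea]; first by rewrite s0.
have ua : u `^ a <= d / (C + 1).
  apply: (le_trans (powR_decr e0 ea _)); first by rewrite u0 (le_trans us).
  apply: (@le_trans _ _ (((d / (C + 1)) `^ e^-1) `^ e)).
    apply: ge0_ler_powR; rewrite ?nnegrE ?powR_ge0 ?(ltW e0)//.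
    by apply: (le_trans us); rewrite ge_min lexx orbT.
  by rewrite -powRrM mulVf ?gt_eqF// powRr1// divr_ge0 ?ltW.
have := ler_wpM2l C0 ua; move/le_trans; apply.
by rewrite mulrCA ger_pMr// ler_pdivrMr//; lra.
Qed.

End powers.

(** * Lipschitz regularization of Hoelder functions *)

Section regularization.
Context {R : realType} {X : pmetricType R}.
Implicit Types f g h F : X -> R.

Definition holder_with (K e : R) f : Prop :=
  forall x y, `|f x - f y| <= K * mdist x y `^ e.

Definition lipschitz_with (L : R) f : Prop :=
  forall x y, `|f x - f y| <= L * mdist x y.

(** With slope [L = K / r^(1 - e)] the lines [L d] and the moduli [K d^e] cross at
    [d = r]: beyond [r] the penalty wins, so the infimum only sees points at
    distance less than [r], and below [r] an [L]-Lipschitz function satisfies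
    the Hoelder bound with constant [K].  The factor 2 pays, at distances beyond
    [r], for the error [K r^e] of the approximation. *)
Lemma inf_convolution F (K e r : R) : 0 <= K -> 0 < e < 1 -> 0 < r ->
    (forall x, 0 <= F x) -> holder_with K e F ->
  exists g, [/\ forall x, 0 <= g x <= F x, exists L, lipschitz_with L g,
    forall x, F x - g x <= K * r `^ e & holder_with (2 * K) e g].
Proof.
move=> K0 /andP[e0 e1] r0 F0 FK; pose L := K / r `^ (1 - e).
have L0 : 0 <= L by rewrite divr_ge0 ?powR_ge0.
have rL : L * r `^ (1 - e) = K by rewrite divfK// gt_eqF// powR_gt0.
have far d : r <= d -> K * d `^ e <= L * d.
  move=> rd; have d0 : 0 <= d by apply: le_trans rd; apply: ltW.
  rewrite -{2}(@powR_mul_compl _ e _ d0) -rL -mulrA ler_wpM2l//.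
  rewrite mulrC ler_wpM2l ?powR_ge0//.
  by apply: ge0_ler_powR; rewrite ?nnegrE ?subr_ge0// ?(ltW r0) ?(ltW e1).
have near d : 0 <= d -> d <= r -> L * d <= K * d `^ e.
  move=> d0 dr; rewrite -{1}(@powR_mul_compl _ e _ d0) -rL -mulrA ler_wpM2l//.
  rewrite mulrC ler_wpM2r ?powR_ge0//.
  by apply: ge0_ler_powR; rewrite ?nnegrE ?subr_ge0// ?(ltW r0) ?(ltW e1).
have gap d : 0 <= d -> K * d `^ e <= L * d + K * r `^ e.
  move=> d0; have [rd|/ltW dr] := leP r d.
    by apply: (le_trans (far d rd)); rewrite lerDl mulr_ge0 ?powR_ge0.
  rewrite (@le_trans _ _ (K * r `^ e))//; last by rewrite lerDr mulr_ge0.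
  by rewrite ler_wpM2l// ge0_ler_powR// ?nnegrE ltW.
pose E x := [set F y + L * mdist x y | y in [set: X]].
have E0 x : has_lbound (E x).
  by exists 0 => _ [y _ <-]; apply: addr_ge0 => //; rewrite mulr_ge0 ?mdist_ge0.
have leE x y : inf (E x) <= F y + L * mdist x y.
  by apply: ge_inf => //; exists y.
have geE x c : (forall y, c <= F y + L * mdist x y) -> c <= inf (E x).
  move=> cF; apply: lb_le_inf; first by exists (F x + L * mdist x x), x.
  by move=> _ [y _ <-].
have gF x : 0 <= inf (E x) <= F x.
  apply/andP; split.
    by apply: geE => y; apply: addr_ge0 => //; rewrite mulr_ge0 ?mdist_ge0.
  by apply: (le_trans (leE x x)); rewrite mdistxx mulr0 addr0.
have gL : lipschitz_with L (fun x => inf (E x)).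
  suff H x y : inf (E x) - inf (E y) <= L * mdist x y.
    move=> x y; rewrite ler_norml lerNl opprB H andbT.
    by rewrite (metric_sym x) H.
  rewrite lerBlDl -lerBlDr; apply: geE => z; rewrite lerBlDr.
  apply: (le_trans (leE x z)); rewrite -addrA lerD2l -mulrDr ler_wpM2l//.
  by rewrite addrC metric_triangle.
have Fg x : F x - inf (E x) <= K * r `^ e.
  rewrite lerBlDl -lerBlDr; apply: geE => y; rewrite lerBlDr -addrA -lerBlDl.
  apply: le_trans (gap _ (mdist_ge0 _ _)).
  exact: le_trans (ler_norm _) (FK _ _).
exists (fun x => inf (E x)); split => //; first by exists L.
move=> x y; have [rd|/ltW dr] := leP r (mdist x y).
  have H u v : r <= mdist u v -> inf (E u) - inf (E v) <= 2 * K * mdist u v `^ e.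
    move=> ruv; have := gF u; have := Fg v; have := le_trans (ler_norm _) (FK u v).
    have : K * r `^ e <= K * mdist u v `^ e.
      by rewrite ler_wpM2l// ge0_ler_powR// ?nnegrE ?mdist_ge0// ltW.
    move=> a b c /andP[_ d]; lra.
  rewrite ler_norml lerNl opprB H// andbT.
  by rewrite (metric_sym x) H// metric_sym.
apply: (le_trans (gL x y)); apply: (le_trans (near _ (mdist_ge0 _ _) dr)).
by rewrite ler_wpM2r ?powR_ge0//; lra.
Qed.

End regularization.

(** * Real-valued test functions *)

Section real_test_functions.
Context {R : realType} {X : pmetricType R}.
Variable mu : {measure set (borelType X) -> \bar R}.
Hypothesis hball : ball_measure_finite_pos mu.
Variable x1 : X.
Implicit Types (f g h F : X -> R) (a b C K M N d : R).

Local Notation ts := (test_size mu x1 1).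
Local Notation rho x := (1 + mdist x1 x).

(** The real-valued counterpart of [test_bound] at scale 1, so that order and
    truncation arguments can be carried out on real and imaginary parts. *)
Definition real_test_bound a b f C : Prop :=
  [/\ 0 <= C, forall x, `|f x| <= C * ts b x &
    forall x y, mdist x y <= rho x / 2 ->
      `|f x - f y| <= C * (mdist x y / rho x) `^ a * ts b x].

Lemma open_mball (x : X) (r : R) : open (ball x r).
Proof.
rewrite openE => y; rewrite ballEmdist /= => xyr.
apply/nbhs_ballP; exists (r - mdist x y); first by rewrite /= subr_gt0.
move=> z; rewrite !ballEmdist /= ltrBrDl; apply: le_lt_trans.
exact: metric_triangle.
Qed.

Lemma measurable_open (U : set X) : open U -> measurable (U : set (borelType X)).
Proof. exact: sub_sigma_algebra. Qed.

Lemma Vr_gt0 (x : X) (r : R) : 0 < r -> 0 < Vr mu r x.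
Proof.
move=> r0; have /andP[m0 moo] := hball x r0.
by apply: fine_gt0; rewrite m0.
Qed.

Lemma Vr_ge0 (x : X) (r : R) : 0 <= Vr mu r x.
Proof. by apply: fine_ge0; apply: measure_ge0. Qed.

(** A nonpositive radius [r] gives the empty ball, which covers [V x1 x1]. *)
Lemma Vr_mono (x : X) (r s : R) : r <= s -> 0 < s -> Vr mu r x <= Vr mu s x.
Proof.
move=> rs s0; have [r0|r0] := ltP 0 r.
  have /andP[_ rfin] := hball x r0; have /andP[_ sfin] := hball x s0.
  apply: fine_le.
  - by rewrite ge0_fin_numE.
  - by rewrite ge0_fin_numE.
  apply: le_measure.
  - by rewrite inE; apply: measurable_open (open_mball x r).
  - by rewrite inE; apply: measurable_open (open_mball x s).
  by move=> y; rewrite !ballEmdist /= => /lt_le_trans; apply.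
rewrite /Vr; suff -> : ball x r = set0 by rewrite measure0 Vr_ge0.
rewrite ballEmdist -subset0 => y /= /lt_le_trans /(_ r0).
by rewrite ltNge mdist_ge0.
Qed.

Lemma rho_ge1 x : 1 <= rho x.
Proof. by rewrite lerDl mdist_ge0. Qed.

Lemma rho_inv01 x : 0 <= 1 / rho x <= 1.
Proof.
have r1 := rho_ge1 x; have r0 := lt_le_trans ltr01 r1.
by rewrite divr_ge0 ?(ltW r0)//= ler_pdivrMr// mul1r.
Qed.

Lemma test_size_gt0 b x : 0 < ts b x.
Proof.
rewrite mulr_gt0 ?powR_gt0 ?divr_gt0 ?(lt_le_trans ltr01 (rho_ge1 x))//.
by rewrite invr_gt0 ltr_pwDl ?Vr_gt0 ?Vr_ge0.
Qed.

Lemma test_size_ge0 b x : 0 <= ts b x.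
Proof. exact: ltW (test_size_gt0 _ _). Qed.

(** The supremum of the weights: [test_size] at [x1]. *)
Definition test_size_max : R := (Vr mu 1 x1)^-1.

Lemma test_size_max_gt0 : 0 < test_size_max.
Proof. by rewrite invr_gt0 Vr_gt0. Qed.

Lemma test_size_decay b x : ts b x <= test_size_max * (1 / rho x) `^ b.
Proof.
rewrite ler_wpM2r ?powR_ge0// lef_pV2 ?posrE ?ltr_pwDl ?Vr_gt0 ?Vr_ge0//.
by rewrite lerDl Vr_ge0.
Qed.

Lemma test_size_le_max b x : 0 <= b -> ts b x <= test_size_max.
Proof.
move=> b0; apply: (le_trans (test_size_decay b x)).
by rewrite ger_pMr ?test_size_max_gt0// powR_le1// rho_inv01.
Qed.

Lemma test_size_split a b x : 0 < b -> b <= a ->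
  ts a x = (1 / rho x) `^ (a - b) * ts b x.
Proof. by move=> b0 ba; rewrite /test_size (powR_subrK b0 ba) mulrCA. Qed.

(** On a ball around [x1] all the weights are comparable to constants, because
    balls have finite measure; this is what turns uniform estimates into weighted
    ones. *)
Lemma test_size_lower b N : 0 <= b ->
  exists2 c : R, 0 < c & forall x, mdist x1 x <= N -> c <= ts b x.
Proof.
move=> b0; pose M := Num.max 1 N.
have M0 : 0 < M by rewrite lt_max ltr01.
have M1 : 0 < 1 + M by rewrite addr_gt0.
exists ((Vr mu 1 x1 + Vr mu M x1)^-1 * (1 / (1 + M)) `^ b) => [|x xN].
  by rewrite mulr_gt0 ?powR_gt0 ?divr_gt0// invr_gt0 addr_gt0 ?Vr_gt0.
have xM : mdist x1 x <= M by rewrite le_max xN orbT.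
have r0 : 0 < rho x by rewrite (lt_le_trans ltr01 (rho_ge1 x)).
apply: ler_pM; rewrite ?invr_ge0 ?powR_ge0 ?addr_ge0 ?Vr_ge0//.
  rewrite lef_pV2 ?posrE ?ltr_pwDl ?Vr_gt0 ?Vr_ge0// lerD2l.
  exact: Vr_mono.
apply: ge0_ler_powR; rewrite ?nnegrE ?divr_ge0 ?(ltW M1) ?(ltW r0)//.
by rewrite !div1r lef_pV2 ?posrE// lerD2l.
Qed.

Lemma real_test_boundD a b f g C K :
  real_test_bound a b f C -> real_test_bound a b g K ->
  real_test_bound a b (f \+ g) (C + K).
Proof.
move=> [C0 fC fC'] [K0 gK gK']; split; first exact: addr_ge0.
- by move=> x; rewrite mulrDl; apply: (le_trans (ler_normD _ _)); rewrite lerD.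
- move=> x y xy; rewrite !mulrDl /= opprD addrACA.
  by apply: (le_trans (ler_normD _ _)); rewrite lerD ?fC' ?gK'.
Qed.

Lemma real_test_boundZ a b f C k :
  real_test_bound a b f C -> real_test_bound a b (fun x => k * f x) (`|k| * C).
Proof.
move=> [C0 fC fC']; split; first by rewrite mulr_ge0.
- by move=> x; rewrite normrM -mulrA ler_wpM2l.
- by move=> x y xy; rewrite -mulrBr normrM -!mulrA ler_wpM2l// mulrA fC'.
Qed.

(** Used with [g] obtained from [f] by a 1-Lipschitz map fixing 0: truncations and
    positive and negative parts inherit the bounds of [f]. *)
Lemma real_test_bound_contraction a b f g C :
  (forall x, `|g x| <= `|f x|) -> (forall x y, `|g x - g y| <= `|f x - f y|) ->
  real_test_bound a b f C -> real_test_bound a b g C.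
Proof.
move=> gf gf' [C0 fC fC']; split=> // [x|x y xy]; first exact: le_trans (fC x).
exact: le_trans (fC' x y xy).
Qed.

Lemma ratio01 x y : mdist x y <= rho x / 2 -> 0 <= mdist x y / rho x <= 1.
Proof.
have r1 := rho_ge1 x; have r0 := lt_le_trans ltr01 r1; move=> xy.
rewrite divr_ge0 ?mdist_ge0 ?(ltW r0)//= ler_pdivrMr// mul1r.
by apply: (le_trans xy); lra.
Qed.

(** Interpolation.  If [1 / (1 + d(x1, x))] or the ratio
    [d(x, y) / (1 + d(x1, x))] is at most the threshold [s], the surplus exponents
    [a - b] and [a' - b'] absorb the constant [C].  Otherwise [x] lies in the ball of
    radius [1 / s], the ratio is bounded below by [s], and a sup bound on [h] is
    enough. *)
Lemma real_test_bound_small a a' b b' C d : 0 <= C -> 0 < d ->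
    0 < b < a -> 0 < b' < a' ->
  exists2 eta : R, 0 < eta & forall h, real_test_bound a a' h C ->
    (forall x, `|h x| <= eta) -> real_test_bound b b' h d.
Proof.
move=> C0 d0 /andP[b0 ba] /andP[b'0 b'a'].
pose e := Num.min (a - b) (a' - b').
have e0 : 0 < e by rewrite lt_min !subr_gt0 ba.
have ea : e <= a - b by rewrite ge_min lexx.
have ea' : e <= a' - b' by rewrite ge_min lexx orbT.
have [s /andP[s0 s1] hs] := powR_small C0 d0 e0.
have [c c0 hc] := test_size_lower s^-1 (ltW b'0).
have sb : 0 < s `^ b by rewrite powR_gt0.
have sb1 : s `^ b <= 1 by rewrite powR_le1 ?(ltW b0) ?(ltW s0).
exists (d * s `^ b * c / 2) => [|h [_ hC hC'] heta].
  by rewrite divr_gt0 ?mulr_gt0.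
have center x : s < 1 / rho x -> c <= ts b' x.
  move=> sx; apply: hc; apply: (@le_trans _ _ (rho x)); first by rewrite lerDr.
  have r0 := lt_le_trans ltr01 (rho_ge1 x).
  by rewrite -[leLHS]invrK lef_pV2 ?posrE ?invr_gt0// -[leRHS]div1r ltW.
split=> [|x|x y xy]; first exact: ltW.
- have [xs|sx] := leP (1 / rho x) s.
    apply: (le_trans (hC x)); rewrite (test_size_split x b'0 (ltW b'a')) mulrA.
    rewrite ler_wpM2r ?test_size_ge0// hs//.
    by have /andP[-> _] := rho_inv01 x.
  apply: (le_trans (heta x)); apply: (@le_trans _ _ (d * c)).
    have : d * s `^ b * c <= d * c.
      by rewrite -mulrA ler_wpM2l ?(ltW d0)// ler_piMl// ltW.
    have : 0 <= d * s `^ b * c by rewrite !mulr_ge0// ltW.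
    lra.
  by rewrite ler_wpM2l ?(ltW d0)// center.
have t01 := ratio01 xy; set t := mdist x y / rho x in t01 *.
have [t0 t1] := andP t01.
have [good|/norP[]] := boolP ((1 / rho x <= s) || (t <= s)).
  apply: (le_trans (hC' x y xy)); rewrite -/t.
  rewrite (test_size_split x b'0 (ltW b'a')) (powR_subrK b0 (ltW ba)).
  set u := 1 / rho x in good *; have u01 : 0 <= u <= 1 := rho_inv01 x.
  have -> : C * (t `^ (a - b) * t `^ b) * (u `^ (a' - b') * ts b' x) =
            (C * (t `^ (a - b) * u `^ (a' - b'))) * (t `^ b * ts b' x) by ring.
  rewrite -[leRHS]mulrA ler_wpM2r//.
    by rewrite mulr_ge0 ?powR_ge0 ?test_size_ge0.
  have tp : 0 <= t `^ (a - b) <= 1.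
    by rewrite powR_ge0 powR_le1// subr_ge0 ltW.
  have up : 0 <= u `^ (a' - b') <= 1.
    by rewrite powR_ge0 powR_le1// subr_ge0 ltW.
  case/orP: good => [us|ts].
    apply: le_trans (hs u _ _ ea'); last by case/andP: u01 => ->.
    by rewrite ler_wpM2l// ler_piMl//; case/andP: tp; case/andP: up.
  apply: le_trans (hs t _ _ ea); last by rewrite t0.
  by rewrite ler_wpM2l// ler_piMr//; case/andP: tp; case/andP: up.
rewrite -!ltNge => /center cx st.
apply: (le_trans (ler_normB _ _)).
apply: (@le_trans _ _ (d * s `^ b * c)).
  by have := heta x; have := heta y; lra.
rewrite ler_pM ?mulr_ge0 ?(ltW d0) ?(ltW c0) ?(ltW sb)// ler_wpM2l ?(ltW d0)//.
by apply: ge0_ler_powR; rewrite ?nnegrE ?(ltW b0) ?(ltW s0) ?(ltW st).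
Qed.

Lemma real_test_bound_max a b f C : 0 <= b -> real_test_bound a b f C ->
  forall x, `|f x| <= C * test_size_max.
Proof.
move=> b0 [C0 fC _] x; apply: (le_trans (fC x)).
by rewrite ler_wpM2l// test_size_le_max.
Qed.

(** For [d(x, y)] beyond half of [1 + d(x1, x) >= 1] the sup bound on [f] takes
    over; the factor 4 is 2 divided by the lower bound 1 / 2 of [d(x, y)^a]. *)
Lemma real_test_bound_holder a b f C : 0 < a <= 1 -> 0 <= b ->
  real_test_bound a b f C -> holder_with (4 * (C * test_size_max)) a f.
Proof.
move=> /andP[a0 a1] b0 fC x y; have fmax := real_test_bound_max b0 fC.
case: fC => C0 _ fC; have W0 := test_size_max_gt0.
set W := test_size_max in fmax W0 *.
have CW : 0 <= C * W by rewrite mulr_ge0 ?(ltW W0).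
have r1 := rho_ge1 x; have r0 := lt_le_trans ltr01 r1.
have d0 : 0 <= mdist x y := mdist_ge0 x y.
have [xy|xy] := leP (mdist x y) (rho x / 2).
  apply: (le_trans (fC x y xy)).
  apply: (@le_trans _ _ (C * W * mdist x y `^ a)).
    rewrite mulrAC ler_pM ?(mulr_ge0 C0) ?powR_ge0 ?test_size_ge0//.
      by rewrite ler_wpM2l// test_size_le_max.
    apply: ge0_ler_powR; rewrite ?nnegrE ?divr_ge0 ?(ltW a0) ?(ltW r0)//.
    by rewrite ler_pdivrMr// ler_peMr.
  by rewrite ler_wpM2r ?powR_ge0//; lra.
apply: (le_trans (ler_normB _ _)).
have h2 : 1 / 2 <= mdist x y `^ a.
  apply: (@le_trans _ _ ((1 / 2) `^ a)).
    have := @powR_decr R 1 a (1/2) a0 a1; rewrite powRr1; last by lra.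
    by apply; lra.
  by apply: ge0_ler_powR; rewrite ?nnegrE ?(ltW a0)//; lra.
have := ler_wpM2l (mulr_ge0 (ler0n R 4) CW) h2.
by have := fmax x; have := fmax y; lra.
Qed.

(** If [x] or [y] is in the ball of radius [N] and [d(x, y) <= (1 + d(x1, x)) / 2],
    then [d(x1, x) <= 2 N + 1], and the weights are bounded below there.  The constant
    [C] is chosen before [F]: regularizations of one function stay bounded in the
    space of test functions. *)
Lemma bounded_support_test_bound a b N M K :
    0 < a <= 1 -> 0 <= b -> 0 <= M -> 0 <= K -> 0 <= N ->
  exists C, forall F, (forall x, `|F x| <= M) -> holder_with K a F ->
    (forall x, N <= mdist x1 x -> F x = 0) -> real_test_bound a b F C.
Proof.
move=> /andP[a0 a1] b0 M0 K0 N0.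
have [c c0 hc] := test_size_lower (2 * N + 1) b0.
have C0 : 0 <= M + K * (2 * N + 2) by rewrite addr_ge0 ?mulr_ge0//; lra.
exists ((M + K * (2 * N + 2)) / c) => F FM FK F0.
split=> [|x|x y xy]; first by rewrite divr_ge0// ltW.
- have [Nx|xN] := leP N (mdist x1 x).
    by rewrite F0// normr0 mulr_ge0 ?test_size_ge0// divr_ge0// ltW.
  apply: (le_trans (FM x)); apply: (@le_trans _ _ (M + K * (2 * N + 2))).
    by rewrite lerDl mulr_ge0//; lra.
  rewrite -mulrA ler_peMr// mulrC ler_pdivlMr// mul1r hc//; lra.
have r1 := rho_ge1 x; have r0 := lt_le_trans ltr01 r1.
have [xN|xN] := leP (mdist x1 x) (2 * N + 1); last first.
  have Nx : N <= mdist x1 x by lra.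
  have Ny : N <= mdist x1 y.
    by have := metric_triangle x1 y x; rewrite (metric_sym y x); lra.
  rewrite !F0// subrr normr0 mulr_ge0 ?test_size_ge0// mulr_ge0 ?powR_ge0//.
  by rewrite divr_ge0// ltW.
apply: (le_trans (FK x y)).
set t := mdist x y / rho x.
have t0 : 0 <= t by rewrite mulr_ge0 ?mdist_ge0// invr_ge0 ltW.
have -> : mdist x y = rho x * t by rewrite mulrCA divff ?mulr1// gt_eqF.
rewrite powRM ?(ltW r0)// mulrA -mulrA -[leRHS]mulrA.
have tc : t `^ a <= t `^ a * (ts b x / c).
  by rewrite ler_peMr ?powR_ge0// ler_pdivlMr// mul1r hc.
have rp : rho x `^ a <= 2 * N + 2.
  apply: (@le_trans _ _ (rho x)); last by lra.
  by apply: ler1_powR.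
have -> : (M + K * (2 * N + 2)) / c * (t `^ a * ts b x) =
          (M + K * (2 * N + 2)) * (t `^ a * (ts b x / c)) by field; rewrite gt_eqF.
rewrite mulrA ler_pM ?mulr_ge0 ?powR_ge0//.
rewrite -[leLHS]add0r lerD// ler_wpM2l//.
Qed.

Definition bounded_support_lipschitz f : Prop :=
  (exists L, lipschitz_with L f) /\
  (exists2 N : R, 0 <= N & forall x, N <= mdist x1 x -> f x = 0).

Lemma bounded_support_lipschitzD f g : bounded_support_lipschitz f ->
  bounded_support_lipschitz g -> bounded_support_lipschitz (f \+ g).
Proof.
move=> [[L fL] [N N0 fN]] [[L' gL] [N' N'0 gN]]; split.
  exists (L + L') => x y /=; rewrite mulrDl opprD addrACA.
  by apply: (le_trans (ler_normD _ _)); rewrite lerD.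
exists (Num.max N N') => [|x]; first by rewrite le_max N0.
by rewrite ge_max => /andP[/fN fx /gN gx] /=; rewrite fx gx addr0.
Qed.

Lemma bounded_support_lipschitzZ f k : bounded_support_lipschitz f ->
  bounded_support_lipschitz (fun x => k * f x).
Proof.
move=> [[L fL] [N N0 fN]]; split.
  exists (`|k| * L) => x y /=; rewrite -mulrBr normrM -mulrA.
  by rewrite ler_wpM2l.
by exists N => // x /fN ->; rewrite mulr0.
Qed.

Lemma bounded_support_lipschitz_bounded f : bounded_support_lipschitz f ->
  exists2 M : R, 0 <= M & forall x, `|f x| <= M.
Proof.
move=> [[L fL] [N N0 fN]].
have M0 : 0 <= `|f x1| + `|L| * N by rewrite addr_ge0// mulr_ge0.
exists (`|f x1| + `|L| * N) => // x.
have [/fN ->|xN] := leP N (mdist x1 x); first by rewrite normr0.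
have -> : f x = f x1 - (f x1 - f x) by ring.
apply: (le_trans (ler_normB _ _)); rewrite lerD2l.
apply: (le_trans (fL x1 x)); apply: (@le_trans _ _ (`|L| * mdist x1 x)).
  by rewrite ler_wpM2r ?mdist_ge0// ler_norm.
by rewrite ler_wpM2l// ltW.
Qed.

Lemma bounded_support_lipschitz_test a b f : 0 < a <= 1 -> 0 <= b ->
  bounded_support_lipschitz f -> exists C, real_test_bound a b f C.
Proof.
move=> a01 b0 fB; have [M M0 fM] := bounded_support_lipschitz_bounded fB.
case: fB => [[L fL] [N N0 fN]].
have K0 : 0 <= `|L| + 2 * M by rewrite addr_ge0// mulr_ge0.
have [C HC] := bounded_support_test_bound a01 b0 M0 K0 N0.
exists C; apply: HC => // x y.
have /andP[a0 a1] := a01; have d0 : 0 <= mdist x y := mdist_ge0 x y.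
have [d1|d1] := leP 1 (mdist x y).
  have p1 : 1 <= mdist x y `^ a.
    have := @ge0_ler_powR R a (ltW a0) 1 (mdist x y).
    by rewrite powR1 !nnegrE d0 ler01; apply.
  apply: (@le_trans _ _ (`|L| + 2 * M)); last by rewrite ler_peMr.
  apply: (le_trans (ler_normB _ _)).
  by have := fM x; have := fM y; have := normr_ge0 L; lra.
have p1 : mdist x y <= mdist x y `^ a.
  have := @powR_decr R 1 a (mdist x y) a0 a1; rewrite powRr1//; apply.
  by rewrite d0 ltW.
apply: (le_trans (fL x y)); apply: (@le_trans _ _ (`|L| * mdist x y)).
  by rewrite ler_wpM2r// ler_norm.
by rewrite ler_pM// lerDl mulr_ge0.
Qed.

(** Truncation [F = (f - eta)^+] followed by inf-convolution of [F]; both steps are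
    controlled by interpolation.  The inf-convolution of [F] keeps its bounded
    support since it lies between 0 and [F]. *)
Lemma approx_nonneg a a' b b' d f C : 0 < a < 1 -> 0 < b < a -> 0 < b' < a' ->
    0 < d -> (forall x, 0 <= f x) -> real_test_bound a a' f C ->
  exists g, [/\ forall x, 0 <= g x <= f x, bounded_support_lipschitz g &
    real_test_bound b b' (f \- g) d].
Proof.
move=> a01 ba b'a' d0 f0 fC; have /andP[a0 a1] := a01.
have C0 : 0 <= C by case: fC.
have a'0 : 0 < a' by case/andP: b'a' => /lt_trans; apply.
have d20 : 0 < d / 2 by rewrite divr_gt0.
have CW : 0 <= C * test_size_max by rewrite mulr_ge0// ltW// test_size_max_gt0.
have fmax := real_test_bound_max (ltW a'0) fC.
have fH : holder_with (4 * (C * test_size_max)) a f.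
  by apply: real_test_bound_holder fC; rewrite ?a0 ?(ltW a1)// ltW.
set K := 4 * (C * test_size_max) in fH.
have K0 : 0 <= K by rewrite mulr_ge0.
have [eta eta0 heta] := real_test_bound_small C0 d20 ba b'a'.
pose F x := Num.max 0 (f x - eta).
have F0 x : 0 <= F x by rewrite le_max lexx.
have Ff x : F x <= f x.
  by rewrite /F ge_max f0 gerBl ltW.
have fFC : real_test_bound b b' (f \- F) (d / 2).
  apply: heta => [|x].
    apply: real_test_bound_contraction fC => [x|x y] /=; rewrite /F.
      have fx := f0 x; rewrite [leRHS]ger0_norm//.
      case: (leP 0 (f x - eta)) => H; last by rewrite subr0 ger0_norm.
      by rewrite subKr gtr0_norm; lra.
    have := f0 x; have := f0 y.
    case: (leP 0 (f x - eta)) => H1; case: (leP 0 (f y - eta)) => H2 H3 H4;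
    rewrite ?subr0;
    rewrite ler_norml; case: (ger0P (f x - f y)) => H5; apply/andP; split; lra.
  rewrite /= /F ger0_norm ?subr_ge0 ?Ff//.
  by have := f0 x; case: (leP 0 (f x - eta)) => H; lra.
have FH : holder_with K a F.
  move=> x y; apply: le_trans (fH x y); rewrite /F.
  case: (leP 0 (f x - eta)) => H1; case: (leP 0 (f y - eta)) => H2;
  rewrite ?subr0 ?subrr ?normr0//;
  rewrite ler_norml; case: (ger0P (f x - f y)) => H5; apply/andP; split; lra.
have [N N0 FN] : exists2 N : R, 0 <= N & forall x, N <= mdist x1 x -> F x = 0.
  have [s /andP[s0 s1] hs] := powR_small CW eta0 a'0.
  exists s^-1 => [|x sx]; first by rewrite invr_ge0 ltW.
  rewrite /F; apply/max_idPl; rewrite subr_le0.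
  apply: (le_trans (ler_norm _)); case: fC => _ /(_ x) fC _.
  apply: (le_trans fC).
  apply: (@le_trans _ _ (C * (test_size_max * (1 / rho x) `^ a'))).
    by rewrite ler_wpM2l// test_size_decay.
  rewrite mulrA hs//; have r0 := lt_le_trans ltr01 (rho_ge1 x).
  have /andP[-> _] /= := rho_inv01 x.
  rewrite div1r -[leRHS]invrK lef_pV2 ?posrE ?invr_gt0//.
  by rewrite (le_trans sx)// lerDr.
have K30 : 0 <= K + 2 * K by rewrite addr_ge0// mulr_ge0.
have a01' : 0 < a <= 1 by rewrite a0 ltW.
(* The constant [K + 2 * K] bounds the Hoelder constant of [F \- g]. *)
have [C2 HC2] := bounded_support_test_bound a01' (ltW a'0) CW K30 N0.
have C20 : 0 <= C2.
  have [] // := HC2 (fun=> 0).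
  - by move=> x; rewrite normr0.
  - by move=> x y; rewrite subrr normr0 mulr_ge0 ?powR_ge0.
have [eta2 eta20 heta2] := real_test_bound_small C20 d20 ba b'a'.
have [r /andP[r0 _] hr] := powR_small K0 eta20 a0.
have [g [gF gL Fg gH]] := inf_convolution K0 a01 r0 F0 FH.
have g0 x : 0 <= g x by have /andP[] := gF x.
have gF' x : g x <= F x by have /andP[] := gF x.
exists g; split=> [x||].
- by rewrite g0 (le_trans (gF' x)).
- split=> //; exists N => // x /FN Fx; apply/eqP.
  by rewrite eq_le g0 andbT -Fx.
have -> : f \- g = (f \- F) \+ (F \- g).
  by apply/funext => x /=; rewrite addrA subrK.
rewrite [d]splitr; apply: real_test_boundD => //; apply: heta2.
  apply: HC2 => [x|x y|x Nx] /=.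
  - rewrite ger0_norm ?subr_ge0//; apply: le_trans (fmax x).
    rewrite ger0_norm//; have := g0 x; have := Ff x; lra.
  - have -> : F x - g x - (F y - g y) = (F x - F y) - (g x - g y) by ring.
    rewrite mulrDl.
    by apply: (le_trans (ler_normB _ _)); rewrite lerD.
  - by have := gF' x; have := g0 x; rewrite FN//; lra.
move=> x /=; rewrite ger0_norm ?subr_ge0//; apply: (le_trans (Fg x)).
by rewrite hr// lexx ltW.
Qed.

(** The bound [|g| <= |f|] provides the domination needed for passing to the limit
    in integrals. *)
Lemma approx_real a a' b b' d f C : 0 < a < 1 -> 0 < b < a -> 0 < b' < a' ->
    0 < d -> real_test_bound a a' f C ->
  exists g, [/\ forall x, `|g x| <= `|f x|, bounded_support_lipschitz g &
    real_test_bound b b' (f \- g) d].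
Proof.
move=> a01 ba b'a' d0 fC; have d20 : 0 < d / 2 by rewrite divr_gt0.
pose fp x := Num.max 0 (f x); pose fn x := Num.max 0 (- f x).
have fp0 x : 0 <= fp x by rewrite le_max lexx.
have fn0 x : 0 <= fn x by rewrite le_max lexx.
have fE x : f x = fp x - fn x.
  by rewrite /fp /fn; case: (leP 0 (f x)); case: (leP 0 (- f x)); lra.
have fA x : `|f x| = Num.max (fp x) (fn x).
  rewrite /fp /fn; case: (ger0P (f x)); case: (leP 0 (- f x)) => H1 H2;
  by [rewrite max_l; lra|rewrite max_r; lra].
have fpC : real_test_bound a a' fp C.
  apply: real_test_bound_contraction fC => [x|x y].
    by rewrite fA ger0_norm// le_max lexx.
  rewrite /fp; case: (leP 0 (f x)); case: (leP 0 (f y)) => H1 H2;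
  rewrite ler_norml; case: (ger0P (f x - f y)) => H5; apply/andP; split; lra.
have fnC : real_test_bound a a' fn C.
  apply: real_test_bound_contraction fC => [x|x y].
    by rewrite fA ger0_norm// le_max lexx orbT.
  rewrite /fn; case: (leP 0 (- f x)); case: (leP 0 (- f y)) => H1 H2;
  rewrite ler_norml; case: (ger0P (f x - f y)) => H5; apply/andP; split; lra.
have [gp [gpf gpL gpd]] := approx_nonneg a01 ba b'a' d20 fp0 fpC.
have [gn [gnf gnL gnd]] := approx_nonneg a01 ba b'a' d20 fn0 fnC.
exists (gp \+ (fun x => -1 * gn x)); split=> [x||].
- have /andP[p0 pf] := gpf x; have /andP[n0 nf] := gnf x.
  rewrite fA /= mulN1r; case: (leP (fp x) (fn x)) => H;
  by rewrite ler_norml; apply/andP; split; lra.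
- apply: bounded_support_lipschitzD => //.
  exact: bounded_support_lipschitzZ.
have := real_test_boundZ (-1) gnd; rewrite normrN1 mul1r => gnd'.
have := real_test_boundD gpd gnd'; rewrite -splitr.
congr (real_test_bound _ _ _ _); apply/funext => x /=; rewrite fE; ring.
Qed.

(** * Mean zero test functions *)

Lemma holder_with_measurable K e f : 0 < e -> holder_with K e f ->
  measurable_fun [set: borelType X] (f : borelType X -> R).
Proof.
move=> e0 fK; apply: (measurability _ (RGenOInfty.measurableE R)).
move=> /= _ [_ [a ->] <-]; apply: measurableI => //; apply: measurable_open.
rewrite openE => y /=; rewrite in_itv /= andbT => ay.
have h0 : 0 < (f y - a) / 2 by rewrite divr_gt0// subr_gt0.
have [s /andP[s0 _] hs] := powR_small (normr_ge0 K) h0 e0.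
apply/nbhs_ballP; exists s => // z; rewrite ballEmdist /= => yz.
rewrite in_itv /= andbT.
have : `|f y - f z| <= (f y - a) / 2.
  apply: (le_trans (fK y z)); apply: (@le_trans _ _ (`|K| * mdist y z `^ e)).
    by rewrite ler_wpM2r ?powR_ge0// ler_norm.
  by apply: hs => //; rewrite mdist_ge0 ltW.
by rewrite ler_norml => /andP[_]; lra.
Qed.

Lemma real_test_bound_measurable a b f C : 0 < a <= 1 -> 0 <= b ->
  real_test_bound a b f C ->
  measurable_fun [set: borelType X] (f : borelType X -> R).
Proof.
move=> a01 b0 fC; have /andP[a0 _] := a01.
exact: holder_with_measurable a0 (real_test_bound_holder a01 b0 fC).
Qed.

Lemma bounded_support_lipschitz_measurable f : bounded_support_lipschitz f ->
  measurable_fun [set: borelType X] (f : borelType X -> R).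
Proof.
move=> [[L fL] _]; apply: (@holder_with_measurable L 1) => // x y.
by rewrite powRr1 ?mdist_ge0.
Qed.

(** The integral is the difference of those of the positive and negative parts, and
    [+oo - +oo] is [-oo]; so a zero integral forces both parts to be finite. *)
Lemma integral_zero_integrable f :
  measurable_fun [set: borelType X] (f : borelType X -> R) ->
  (\int[mu]_x (f x)%:E = 0)%E ->
  mu.-integrable setT (EFin \o (f : borelType X -> R)).
Proof.
move=> mf; rewrite integralE => f0; apply/integrableP; split.
  exact/measurable_EFinP.
have mEf : measurable_fun [set: borelType X] (EFin \o (f : borelType X -> R)).
  exact/measurable_EFinP.
have -> : (\int[mu]_x `|(EFin \o f) x| =
    \int[mu]_x ((EFin \o f)^\+ x + (EFin \o f)^\- x))%E.
  by apply: eq_integral => x _; rewrite -/((abse \o (EFin \o f)) x) fune_abse.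
rewrite ge0_integralD//; [|exact: measurable_funepos|exact: measurable_funeneg].
move: f0; set p := (\int[mu]_x _)%E; set n := (\int[mu]_x _)%E.
have p0 : (0 <= p)%E by apply: integral_ge0.
have n0 : (0 <= n)%E by apply: integral_ge0.
by case: p n p0 n0 => [p| |] [n| |]//= _ _ _; rewrite -EFinD ltry.
Qed.

Lemma bounded_support_lipschitz_integrable f : bounded_support_lipschitz f ->
  mu.-integrable setT (EFin \o (f : borelType X -> R)).
Proof.
move=> fB; have mf := bounded_support_lipschitz_measurable fB.
have [M M0 fM] := bounded_support_lipschitz_bounded fB.
have [_ [N N0 fN]] := fB.
have N10 : 0 < N + 1 by rewrite ltr_wpDl.
pose B : set (borelType X) := ball x1 (N + 1).
have mB : measurable B by exact: measurable_open (open_mball _ _).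
have -> : EFin \o (f : borelType X -> R) = (EFin \o f) \_ B.
  apply/funext => x; rewrite patchE; case: ifPn => //; rewrite notin_setE.
  rewrite /B ballEmdist /= => /negP; rewrite -leNgt => Nx.
  by rewrite fN// (le_trans _ Nx)// lerDl.
apply/(integrable_mkcond _ mB); apply: measurable_bounded_integrable => //.
- by have /andP[] := hball x1 N10.
- exact: measurable_funS mf.
- exists M; split; first exact: ger0_real.
  by move=> K MK x _; apply: (le_trans (fM x)); exact: ltW.
Qed.

(** The tent [max(0, 1 - d(x1, x))] is at least 1 / 2 on the ball of radius 1 / 2,
    which has positive measure. *)
Lemma exists_bump : exists g, bounded_support_lipschitz g /\
  0 < (\int[mu]_x (g : borelType X -> R) x)%R.
Proof.
pose g x := Num.max 0 (1 - mdist x1 x).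
have gB : bounded_support_lipschitz g.
  split; last first.
    by exists 1 => // x x1'; rewrite /g; apply/max_idPl; rewrite subr_le0.
  exists 1 => x y; rewrite mul1r /g.
  have := metric_triangle x1 x y; have := metric_triangle x1 y x.
  rewrite (metric_sym y x) => h1 h2; have h3 := mdist_ge0 x y.
  case: (leP 0 (1 - mdist x1 x)) => H1; case: (leP 0 (1 - mdist x1 y)) => H2;
  rewrite ler_norml; apply/andP; split; lra.
exists g; split=> //; have ig := bounded_support_lipschitz_integrable gB.
have mg := bounded_support_lipschitz_measurable gB.
have g0 x : 0 <= g x by rewrite le_max lexx.
have h0 : 0 < 1 / 2 :> R by [].
pose B : set (borelType X) := ball x1 (1 / 2).
have mB : measurable B by exact: measurable_open (open_mball _ _).
rewrite -lte_fin fineK; last exact: integrable_fin_num ig.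
have /andP[B0 Boo] := hball x1 h0.
apply: (@lt_le_trans _ _ (\int[mu]_(x in B) (1 / 2)%:E)%E).
  by rewrite integral_cst//; apply: mule_gt0; rewrite ?lte_fin.
apply: (@le_trans _ _ (\int[mu]_(x in B) (g x)%:E)%E).
  apply: ge0_le_integral => //.
  - by apply/measurable_EFinP; exact: measurable_funS mg.
  - move=> x; rewrite /B ballEmdist /= => xB; rewrite lee_fin /g le_max.
    by apply/orP; right; lra.
apply: ge0_subset_integral => //; first exact/measurable_EFinP.
by move=> x _; rewrite lee_fin.
Qed.

Lemma real_test_bound_le a b f C K : C <= K ->
  real_test_bound a b f C -> real_test_bound a b f K.
Proof.
move=> CK [C0 fC fC']; split; first exact: le_trans CK.
- by move=> x; apply: (le_trans (fC x)); rewrite ler_wpM2r ?test_size_ge0.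
- move=> x y xy; apply: (le_trans (fC' x y xy)).
  by rewrite ler_wpM2r ?test_size_ge0// ler_wpM2r ?powR_ge0.
Qed.

(** [approx_real] yields [g_n -> f] with [|g_n| <= |f|], hence integrals [J] of
    [g_n] tending to 0; for large [n] the correction [g_n - (J / I) h], with [h] a
    bump of integral [I], is still within [d] of [f]. *)
Lemma approx_real_mean0 a a' b b' d f C : 0 < a < 1 -> 0 < b < a -> 0 < b' < a' ->
    0 < d -> real_test_bound a a' f C -> (\int[mu]_x (f x)%:E = 0)%E ->
  exists g, [/\ bounded_support_lipschitz g, real_test_bound b b' (f \- g) d &
    (\int[mu]_x (g x)%:E = 0)%E].
Proof.
move=> a01 ba b'a' d0 fC f0; have d20 : 0 < d / 2 by rewrite divr_gt0.
have [b0 b'0] : 0 < b /\ 0 < b' by case/andP: ba; case/andP: b'a'.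
have b01 : 0 < b <= 1 by move: a01 ba => /andP[? ?] /andP[-> ?] /=; lra.
have mf : measurable_fun [set: borelType X] (f : borelType X -> R).
  move: a01 b'a' => /andP[a0 a1] /andP[_ b'a'].
  apply: real_test_bound_measurable fC; first by rewrite a0 ltW.
  by rewrite ltW// (lt_trans b'0).
have intf := integral_zero_integrable mf f0.
have dn n : 0 < d / 2 * n.+1%:R^-1 by rewrite mulr_gt0.
have /choice [g_ hg] n := approx_real a01 ba b'a' (dn n) fC.
have gB n : bounded_support_lipschitz (g_ n) by have [] := hg n.
have g_f x : g_ n x @[n --> \oo] --> f x.
  apply/cvgrPdist_le => e e0.
  have : (d / 2 * ts b' x) * n.+1%:R^-1 @[n --> \oo] --> 0.
    rewrite -(mulr0 (d / 2 * ts b' x)); apply: cvgM; first exact: cvg_cst.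
    exact: cvg_harmonic.
  move/cvgr0_norm_le => /(_ e e0); apply: filterS => n.
  rewrite ger0_norm; last by rewrite mulr_ge0// mulr_ge0 ?test_size_ge0// ltW.
  by apply: le_trans; rewrite mulrAC; have [_ _ [_ H _]] := hg n; exact: H.
have Ig : (fun n => \int[mu]_x (g_ n x)%:E)%E @ \oo --> 0%E.
  rewrite -f0; apply: (@dominated_cvg _ _ _ mu setT measurableT _ _
      (abse \o (EFin \o (f : borelType X -> R)))) => //.
  - move=> n; apply/measurable_EFinP.
    exact: bounded_support_lipschitz_measurable.
  - by move=> x _; apply/fine_cvgP; split; [exact: nearW|exact: g_f].
  - exact: integrable_abse.
  - by move=> n x _ /=; rewrite lee_fin; have [H _ _] := hg n.
have [h [hB Ih]] := exists_bump; set I := (\int[mu]_x _)%R in Ih.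
have [H hH] := bounded_support_lipschitz_test b01 (ltW b'0) hB.
have H0 : 0 <= H by case: hH.
(* How small [J] must be: then [|J / I| * H <= d / 2]. *)
pose k := d / 2 * I / (H + 1).
have H10 : 0 < H + 1 by rewrite ltr_wpDl.
have k0 : 0 < k by rewrite divr_gt0// mulr_gt0.
have /fine_cvgP[_ /cvgr0_norm_le /(_ k k0)] := Ig.
move=> [n _ /(_ n (leqnn n))] /= nk.
set J := fine _ in nk.
have ig := bounded_support_lipschitz_integrable (gB n).
have ih := bounded_support_lipschitz_integrable hB.
have cB := bounded_support_lipschitzZ (- (J / I)) hB.
exists (g_ n \+ (fun x => - (J / I) * h x)); split.
- exact: bounded_support_lipschitzD.
- have [_ _ fg] := hg n.
  have fg' : real_test_bound b b' (f \- g_ n) (d / 2).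
    by apply: real_test_bound_le fg; rewrite ger_pMr// invf_le1// ler1n.
  have ch : real_test_bound b b' (fun x => J / I * h x) (d / 2).
    apply: real_test_bound_le (real_test_boundZ (J / I) hH).
    rewrite normrM normfV (gtr0_norm Ih) mulrAC ler_pdivrMr//.
    apply: (@le_trans _ _ (k * H)); first by rewrite ler_wpM2r.
    rewrite /k mulrAC ler_pdivrMr// ler_wpM2l//; last by rewrite lerDl.
    by rewrite mulr_ge0 ?(ltW Ih)// ltW.
  have := real_test_boundD fg' ch; rewrite -splitr.
  by congr (real_test_bound _ _ _ _); apply/funext => x /=; ring.
have ic := bounded_support_lipschitz_integrable cB.
have igc := bounded_support_lipschitz_integrable
  (bounded_support_lipschitzD (gB n) cB).
rewrite -[LHS]fineK; last exact: integrable_fin_num igc.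
congr EFin; rewrite -/(Rintegral _ _ _) RintegralD// RintegralZl//.
by rewrite -/I mulNr divfK ?gt_eqF// subrr.
Qed.

(** * Complex-valued test functions and completions *)

Implicit Types (phi psi : X -> R[i]) (z : R[i]).
Local Notation Re := (@complex.Re R).
Local Notation Im := (@complex.Im R).

Lemma normc_ge_Re z : `|Re z| <= Normc.normc z.
Proof. by case: z => a b /=; rewrite -sqrtr_sqr ler_wsqrtr// lerDl sqr_ge0. Qed.

Lemma normc_ge_Im z : `|Im z| <= Normc.normc z.
Proof. by case: z => a b /=; rewrite -sqrtr_sqr ler_wsqrtr// lerDr sqr_ge0. Qed.

Lemma normc_le_ReIm z : Normc.normc z <= `|Re z| + `|Im z|.
Proof.
case: z => a b /=; have ab0 : 0 <= `|a| + `|b| by rewrite addr_ge0.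
rewrite -[leRHS]ger0_norm// -[leRHS]sqrtr_sqr ler_wsqrtr//.
rewrite sqrrD !real_normK ?num_real// addrAC lerDl.
by rewrite mulrn_wge0// mulr_ge0.
Qed.

Lemma ReB z z' : Re (z - z') = Re z - Re z'.
Proof. by case: z; case: z'. Qed.

Lemma ImB z z' : Im (z - z') = Im z - Im z'.
Proof. by case: z; case: z'. Qed.

Lemma test_bound_Re a b phi C :
  test_bound mu x1 1 a b phi C -> real_test_bound a b (Re \o phi) C.
Proof.
move=> [C0 pC pC']; split=> // [x|x y xy] /=.
  exact: le_trans (normc_ge_Re _) (pC x).
by rewrite -ReB; exact: le_trans (normc_ge_Re _) (pC' x y xy).
Qed.

Lemma test_bound_Im a b phi C :
  test_bound mu x1 1 a b phi C -> real_test_bound a b (Im \o phi) C.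
Proof.
move=> [C0 pC pC']; split=> // [x|x y xy] /=.
  exact: le_trans (normc_ge_Im _) (pC x).
by rewrite -ImB; exact: le_trans (normc_ge_Im _) (pC' x y xy).
Qed.

Lemma test_bound_ReIm a b phi C K :
  real_test_bound a b (Re \o phi) C -> real_test_bound a b (Im \o phi) K ->
  test_bound mu x1 1 a b phi (C + K).
Proof.
move=> [C0 pC pC'] [K0 pK pK']; split=> [|x|x y xy]; first exact: addr_ge0.
  rewrite mulrDl; apply: (le_trans (normc_le_ReIm _)).
  by rewrite lerD; [|exact: pC|exact: pK].
rewrite !mulrDl; apply: (le_trans (normc_le_ReIm _)); rewrite ReB ImB.
by rewrite lerD; [|exact: pC'|exact: pK'].
Qed.

Lemma test_boundD a b phi psi C K :
  test_bound mu x1 1 a b phi C -> test_bound mu x1 1 a b psi K ->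
  test_bound mu x1 1 a b (phi \+ psi) (C + K).
Proof.
move=> [C0 pC pC'] [K0 pK pK']; split=> [|x|x y xy]; first exact: addr_ge0.
  by rewrite mulrDl; apply: (le_trans (le_normcD _ _)); rewrite lerD.
rewrite !mulrDl /= opprD addrACA; apply: (le_trans (le_normcD _ _)).
by rewrite lerD ?pC' ?pK'.
Qed.

Lemma test_boundN a b phi C :
  test_bound mu x1 1 a b phi C -> test_bound mu x1 1 a b (\- phi) C.
Proof.
move=> [C0 pC pC']; split=> // [x|x y xy] /=; first by rewrite normcN.
by rewrite -opprD normcN pC'.
Qed.

(** Both the ratio [d(x, y) / (1 + d(x1, x))] and [1 / (1 + d(x1, x))] are at most 1,
    so smaller exponents give weaker conditions. *)
Lemma test_bound_weaken a a' b b' phi C : 0 < b -> b <= a -> 0 < b' -> b' <= a' ->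
  test_bound mu x1 1 a a' phi C -> test_bound mu x1 1 b b' phi C.
Proof.
move=> b0 ba b'0 b'a' [C0 pC pC'].
have tsle x : ts a' x <= ts b' x.
  rewrite (test_size_split x b'0 b'a') ler_piMl ?test_size_ge0//.
  by rewrite powR_le1 ?rho_inv01// subr_ge0.
split=> // [x|x y xy]; first by apply: (le_trans (pC x)); rewrite ler_wpM2l.
apply: (le_trans (pC' x y xy)).
rewrite ler_pM ?(mulr_ge0 C0) ?powR_ge0 ?test_size_ge0// ler_wpM2l//.
by rewrite powR_decr// ratio01.
Qed.

Lemma testG_norm_le a b phi C :
  test_bound mu x1 1 a b phi C -> testG_norm mu x1 1 a b phi <= C.
Proof. by move=> pC; apply: ge_inf => //; exists 0 => K []. Qed.

Lemma testG_norm_ge0 a b phi : testG mu x1 1 a b phi ->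
  0 <= testG_norm mu x1 1 a b phi.
Proof. by move=> [C pC]; apply: lb_le_inf; [exists C|move=> K []]. Qed.

Lemma testG_normD_le a b phi psi K :
  testG mu x1 1 a b phi -> test_bound mu x1 1 a b psi K ->
  testG_norm mu x1 1 a b (phi \+ psi) <= testG_norm mu x1 1 a b phi + K.
Proof.
move=> [C pC] pK; rewrite -lerBlDr; apply: lb_le_inf; first by exists C.
move=> M pM; rewrite lerBlDr; apply: testG_norm_le; exact: test_boundD.
Qed.

(** Approximating the [i]-th term of a sequence from [P] within [1 / (i + 1)] by an
    element of [Q] does not change the limit.  The inclusion of [P] in the ambient
    space is needed because [testG_norm] only behaves like a norm there: outside, it
    is the infimum of an empty set. *)
Lemma closure_transfer a b (P Q : set (X -> R[i])) phi :
    testG mu x1 1 a b phi -> P `<=` testG mu x1 1 a b ->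
    (forall psi d, P psi -> 0 < d ->
      exists2 psi', Q psi' & test_bound mu x1 1 a b (psi \- psi') d) ->
  (exists2 phi_ : nat -> X -> R[i], forall i, P (phi_ i) &
     testG_cvg mu x1 a b phi_ phi) ->
  exists2 phi_ : nat -> X -> R[i], forall i, Q (phi_ i) &
     testG_cvg mu x1 a b phi_ phi.
Proof.
move=> phiG PG PQ [phi_ phiP phi_cvg].
have /choice[psi_ hpsi] i : exists psi, Q psi /\
    test_bound mu x1 1 a b (phi_ i \- psi) i.+1%:R^-1.
  by have [|psi ? ?] := PQ _ i.+1%:R^-1 (phiP i); last exists psi.
exists psi_ => [i|]; first by have [] := hpsi i.
have dG i : testG mu x1 1 a b (phi \- phi_ i).
  have [C pC] := phiG; have [K pK] := PG _ (phiP i); exists (C + K).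
  exact: test_boundD (test_boundN pK).
have E i : phi \- psi_ i = (phi \- phi_ i) \+ (phi_ i \- psi_ i).
  by apply/funext => x /=; rewrite addrA subrK.
apply: (@squeeze_cvgr _ _ _ _ (cst 0)
  (fun i => testG_norm mu x1 1 a b (phi \- phi_ i) + i.+1%:R^-1)).
- apply: nearW => i; have [_ hi] := hpsi i; rewrite E testG_normD_le// andbT.
  apply: testG_norm_ge0; have [C pC] := dG i.
  by exists (C + i.+1%:R^-1); exact: test_boundD.
- exact: cvg_cst.
- rewrite -[0]addr0; apply: cvgD => //; exact: cvg_harmonic.
Qed.

Lemma bounded_support_lipschitz_testG a phi : 0 < a <= 1 ->
  bounded_support_lipschitz (Re \o phi) -> bounded_support_lipschitz (Im \o phi) ->
  testG mu x1 1 a a phi.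
Proof.
move=> a01 pR pI; have a0 : 0 <= a by case/andP: a01 => /ltW.
have [C hC] := bounded_support_lipschitz_test a01 a0 pR.
have [K hK] := bounded_support_lipschitz_test a01 a0 pI.
by exists (C + K); exact: test_bound_ReIm.
Qed.

(** The approximants are Lipschitz with bounded support, which is why the exponent
    [a'] of the space containing them is independent of [a]. *)
Lemma testG_dense a a' b b' d phi : 0 < a < 1 -> 0 < a' <= 1 ->
    0 < b < a -> 0 < b' < a -> 0 < d -> testG mu x1 1 a a phi ->
  exists2 psi, testG mu x1 1 a' a' psi & test_bound mu x1 1 b b' (phi \- psi) d.
Proof.
move=> a01 a'01 ba b'a d0 [C pC]; have d20 : 0 < d / 2 by rewrite divr_gt0.
have [g [_ gB hg]] := approx_real a01 ba b'a d20 (test_bound_Re pC).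
have [h [_ hB hh]] := approx_real a01 ba b'a d20 (test_bound_Im pC).
exists (fun x => Complex (g x) (h x)).
  exact: bounded_support_lipschitz_testG.
rewrite [d]splitr; apply: test_bound_ReIm.
- by rewrite (_ : _ \o _ = (Re \o phi) \- g)//; apply/funext => x /=; rewrite ReB.
- by rewrite (_ : _ \o _ = (Im \o phi) \- h)//; apply/funext => x /=; rewrite ImB.
Qed.

Lemma testG_mean0_dense a a' b b' d phi : 0 < a < 1 -> 0 < a' <= 1 ->
    0 < b < a -> 0 < b' < a -> 0 < d -> testG_mean0 mu x1 1 a a phi ->
  exists2 psi, testG_mean0 mu x1 1 a' a' psi &
    test_bound mu x1 1 b b' (phi \- psi) d.
Proof.
move=> a01 a'01 ba b'a d0 [[C pC] [pR pI]].
have d20 : 0 < d / 2 by rewrite divr_gt0.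
have [g [gB hg g0]] := approx_real_mean0 a01 ba b'a d20 (test_bound_Re pC) pR.
have [h [hB hh h0]] := approx_real_mean0 a01 ba b'a d20 (test_bound_Im pC) pI.
exists (fun x => Complex (g x) (h x)).
  by split=> //; exact: bounded_support_lipschitz_testG.
rewrite [d]splitr; apply: test_bound_ReIm.
- by rewrite (_ : _ \o _ = (Re \o phi) \- g)//; apply/funext => x /=; rewrite ReB.
- by rewrite (_ : _ \o _ = (Im \o phi) \- h)//; apply/funext => x /=; rewrite ImB.
Qed.

Lemma testG0_sub a a' b b' : 0 < a < 1 -> 0 < a' <= 1 ->
  0 < b < a -> 0 < b' < a -> testG0 mu x1 a b b' `<=` testG0 mu x1 a' b b'.
Proof.
move=> a01 a'01 ba b'a phi [phiG cvg]; split=> //.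
have [/andP[b0 /ltW ba'] /andP[b'0 /ltW b'a']] := (ba, b'a).
apply: closure_transfer cvg => // [psi [C pC]|psi d pG d0].
  by exists C; exact: test_bound_weaken pC.
exact: (testG_dense a01).
Qed.

Lemma testG0_mean0_sub a a' b b' : 0 < a < 1 -> 0 < a' <= 1 ->
  0 < b < a -> 0 < b' < a ->
  testG0_mean0 mu x1 a b b' `<=` testG0_mean0 mu x1 a' b b'.
Proof.
move=> a01 a'01 ba b'a phi [[phiG phi0] cvg]; split=> //.
have [/andP[b0 /ltW ba'] /andP[b'0 /ltW b'a']] := (ba, b'a).
apply: closure_transfer cvg => // [psi [[C pC] _]|psi d pG d0].
  by exists C; exact: test_bound_weaken pC.
exact: (testG_mean0_dense a01).
Qed.

End real_test_functions.

(** * The completions do not depend on the exponent *)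

Unset Implicit Arguments.

Theorem theorem1p1 (R : realType) (X : pmetricType R)
    (mu : {measure set (borelType X) -> \bar R})
    (hreg : regular_measure mu) (hball : ball_measure_finite_pos mu)
    (hRD : RD_space mu) (x1 : X) (eps eps' beta gamma : R)
    (heps : 0 < eps < 1) (heps' : 0 < eps' < 1)
    (hbeta : 0 < beta < Num.min eps eps')
    (hgamma : 0 < gamma < Num.min eps eps') :
  testG0 mu x1 eps beta gamma = testG0 mu x1 eps' beta gamma /\
  testG0_mean0 mu x1 eps beta gamma = testG0_mean0 mu x1 eps' beta gamma.
Proof.
move: hbeta hgamma; rewrite !lt_min => /and3P[b0 be be'] /and3P[c0 ce ce'].
have e1 : 0 < eps <= 1 by case/andP: heps => -> /ltW.
have e1' : 0 < eps' <= 1 by case/andP: heps' => -> /ltW.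
split; apply/seteqP; split.
- by apply: testG0_sub; rewrite ?b0 ?c0.
- by apply: testG0_sub; rewrite ?b0 ?c0.
- by apply: testG0_mean0_sub; rewrite ?b0 ?c0.
- by apply: testG0_mean0_sub; rewrite ?b0 ?c0.
Qed.
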